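(* Let $G$ be a generalized $(m,n)$-ladder graph with paths $G_1=u_1u_2\cdots u_m$ and $G_2=v_1v_2\cdots v_n$. Then $G$ is outerplanar if and only if one of the following holds: (i) $L_G^{\uparrow}(e)\cap R_G^{\uparrow}(e)=L_G^{\downarrow}(e)\cap R_G^{\downarrow}(e)=\emptyset$ for each edge $e\in[G_1,G_2]$; (ii) $L_G^{\uparrow}(e)\cap R_G^{\downarrow}(e)=L_G^{\downarrow}(e)\cap R_G^{\uparrow}(e)=\emptyset$ for each edge $e\in[G_1,G_2]$.
   Context: All graphs are finite, undirected and simple. A graph is outerplanar if it has a planar embedding in which all vertices lie on the outer face. For positive integers $m,n$, a generalized $(m,n)$-ladder graph is a graph $G$ consisting of two vertex-disjoint paths $G_1=u_1u_2\cdots u_m$ and $G_2=v_1v_2\cdots v_n$ together with some (possibly none) edges each of which joins a vertex of $G_1$ and a vertex of $G_2$; there are no other vertices or edges. Let $[G_1,G_2]$ denote the set of edges of $G$ joining a vertex of $G_1$ to a vertex of $G_2$. For $e\in[G_1,G_2]$, let $l(e)$ be the index $i$ of its end $u_i$ on $G_1$ and $r(e)$ the index $j$ of its end $v_j$ on $G_2$. Define $L_G^{\uparrow}(e)=\{e'\in[G_1,G_2]: l(e)<l(e')\le m\}$, $L_G^{\downarrow}(e)=\{e'\in[G_1,G_2]: 1\le l(e')<l(e)\}$, $R_G^{\uparrow}(e)=\{e'\in[G_1,G_2]: r(e)<r(e')\le n\}$, $R_G^{\downarrow}(e)=\{e'\in[G_1,G_2]: 1\le r(e')<r(e)\}$.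 *)

(* Defs.v *)
From mathcomp Require Import all_boot all_order all_algebra.
From mathcomp Require Import all_classical all_reals all_analysis.

Set Implicit Arguments.
Unset Strict Implicit.
Unset Printing Implicit Defensive.

Import Order.TTheory GRing.Theory Num.Theory.
Import numFieldNormedType.Exports.

Local Open Scope classical_set_scope.
Local Open Scope ring_scope.

Record sgraph := SGraph {
  vertex :> finType;
  adj : rel vertex;
  adj_sym : symmetric adj;
  adj_irrefl : irreflexive adj }.

(* The norm of [R * R] is the sup norm; it induces the usual topology and the
   usual bounded sets of the plane. *)
Definition plane (R : realType) : normedModType R := (R * R)%type.

Definition is_arc (R : realType) (A : set (plane R)) (a b : plane R) : Prop :=
  exists f : R -> plane R,
    [/\ {within `[0, 1], continuous f},
        {in `[0, 1] &, injective f},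
        f 0 = a, f 1 = b & f @` `[0, 1] = A].

(* [curve x y] is the point set representing the edge xy; it is only
   constrained when [adj x y]. *)
Record planar_embedding (R : realType) (G : sgraph)
    (pos : G -> plane R) (curve : G -> G -> set (plane R)) : Prop := {
  pos_inj : injective pos;
  curve_sym : forall x y, adj x y -> curve x y = curve y x;
  curve_arc : forall x y, adj x y -> is_arc (curve x y) (pos x) (pos y);
  curve_vertex : forall x y z, adj x y -> curve x y (pos z) ->
    z = x \/ z = y;
  (* With [curve_vertex], distinct edges meet only in a common end. *)
  curve_disjoint : forall x y x' y', adj x y -> adj x' y' ->
    [set x; y]%SET != [set x'; y']%SET ->
    curve x y `&` curve x' y' `<=` range pos }.

Definition drawing (R : realType) (G : sgraph)
    (pos : G -> plane R) (curve : G -> G -> set (plane R)) : set (plane R) :=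
  range pos `|` [set p | exists x y, adj x y /\ curve x y p].

Definition is_face (R : realType) (D F : set (plane R)) : Prop :=
  exists2 p, (~` D) p & F = connected_component (~` D) p.

Definition is_outer_face (R : realType) (D F : set (plane R)) : Prop :=
  is_face D F /\ ~ bounded_set F.

(* A vertex is never a point of a face: lying on a face means lying on its
   boundary, i.e. in its closure. *)
Definition outerplanar (R : realType) (G : sgraph) : Prop :=
  exists (pos : G -> plane R) (curve : G -> G -> set (plane R)),
    planar_embedding pos curve /\
    exists F, is_outer_face (drawing pos curve) F /\
      forall x, closure F (pos x).

Definition consecutive (i j : nat) : bool := (i.+1 == j) || (j.+1 == i).

(* Indices are shifted by one: [u i] is the vertex u_(i+1) and [v j] is
   v_(j+1). *)
Record generalized_ladder (m n : nat) (G : sgraph)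
    (u : 'I_m -> G) (v : 'I_n -> G) : Prop := {
  ladder_u_inj : injective u;
  ladder_v_inj : injective v;
  ladder_disjoint : forall i j, u i <> v j;
  ladder_cover : forall x, (exists i, x = u i) \/ (exists j, x = v j);
  ladder_u_path : forall i i', adj (u i) (u i') = consecutive i i';
  ladder_v_path : forall j j', adj (v j) (v j') = consecutive j j' }.

Section CrossEdges.
Variables (m n : nat) (G : sgraph) (u : 'I_m -> G) (v : 'I_n -> G).
Implicit Type e : 'I_m * 'I_n.

Local Open Scope nat_scope.

(* The edge joining [u i] and [v j] is encoded by the pair [(i, j)]. *)
Definition cross_edges : {set 'I_m * 'I_n} :=
  [set e | adj (u e.1) (v e.2)]%SET.

Definition lidx e : 'I_m := e.1.
Definition ridx e : 'I_n := e.2.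

Definition Lup e := [set e' in cross_edges | lidx e < lidx e']%SET.
Definition Ldown e := [set e' in cross_edges | lidx e' < lidx e]%SET.
Definition Rup e := [set e' in cross_edges | ridx e < ridx e']%SET.
Definition Rdown e := [set e' in cross_edges | ridx e' < ridx e]%SET.

End CrossEdges.

(* Main.v *)
Require Import Defs.
From mathcomp Require Import all_boot all_order all_algebra.
From mathcomp Require Import all_classical all_reals all_analysis.
From mathcomp Require Import zify ring lra.
From Stdlib Require Btauto.

(* A drawing with non-crossing cross edges is obtained by placing the two paths
   on the lines y = 1 and y = 0, the second one reversed in case (i).

   Conversely, suppose that some pair of cross edges is increasing in both
   indices and some pair is increasing in one index and decreasing in the other.
   Then G contains a subdivision of K_{2,3} or of K_4.  A point of a face whose
   closure contains all vertices can be joined to each vertex x by a compact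
   connected set that avoids every edge not incident to x, and this yields a
   K_{3,3} or a K_5 "drawn" with compact connected sets in which independent
   edges are disjoint.  That is impossible by a parity argument in the manner of
   van Kampen: replace every edge by a chain of points with very small steps, and
   for two independent edges e and f follow the direction of x - y along the
   boundary of the square of pairs (x, y) in e * f.  It crosses a fixed ray an
   even number of times, since it does so around each cell of the subdivided
   square.  In the sum of these relations over all pairs of independent edges
   every crossing number occurs an even number of times, but the contributions
   of the half planes containing the differences of the vertices do not cancel. *)

Set Implicit Arguments.
Unset Strict Implicit.
Unset Printing Implicit Defensive.

Import Order.TTheory GRing.Theory Num.Theory.
Import numFieldNormedType.Exports.

Local Open Scope classical_set_scope.
Local Open Scope ring_scope.

(** * Crossing parity of discrete chains *)

Lemma subrACA (V : zmodType) (a b c e : V) :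
  (a - b) - (c - e) = (a - c) - (b - e).
Proof. by rewrite !opprB [e - c]addrC addrACA [- b + e]addrC. Qed.

Section Crossings.
Variable R : realType.
Implicit Types (p q r x y : plane R) (d : R).

(** Only the positive half of the boundary line is included, so that exactly one of p and -p
    qualifies when p is nonzero. *)
Definition upper p : bool := (0 < p.2) || (p.2 == 0) && (0 < p.1).

(* Meaningful only when p and q are closer to each other than to the origin: the
   step from p to q then crosses the positive x-axis or not. *)
Definition crosses p q : bool := (upper p (+) upper q) && (0 < p.1).

Lemma upperN p : p != 0 -> upper (- p) = ~~ upper p.
Proof.
case: p => a b; rewrite /upper /= xpair_eqE !oppr_gt0 oppr_eq0.
by case: (ltrgtP b 0); case: (ltrgtP a 0).
Qed.

Lemma plane_normE p : `|p| = Num.max `|p.1| `|p.2|.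
Proof. by []. Qed.

(** If |p.2| were at least d, then p.2 and q.2 would have the same strict sign; in the sup norm this
    leaves only the first coordinate. *)
Lemma upper_flip d p q : d <= `|p| -> `|p - q| < d -> upper p (+) upper q ->
  d <= `|p.1|.
Proof.
case: p q => [a b] [a' b']; rewrite !plane_normE /upper /=.
rewrite gt_max le_max => /orP [//|db] /andP [_].
move: db; rewrite ler_normr ltr_norml => db hb.
by case: (ltrgtP b 0); case: (ltrgtP b' 0) => //= h1 h2; exfalso; lra.
Qed.

Lemma same_side d p q : d <= `|p.1| -> `|p - q| < d -> (0 < p.1) = (0 < q.1).
Proof.
case: p q => [a b] [a' b']; rewrite !plane_normE /=.
rewrite gt_max => da /andP [+ _]; move: da.
rewrite ler_normr ltr_norml => db hb.
by case: (ltrgtP a 0); case: (ltrgtP a' 0) => //= h1 h2; exfalso; lra.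
Qed.

Lemma crossesC d p q : d <= `|p| -> `|p - q| < d -> crosses q p = crosses p q.
Proof.
move=> dp dpq; rewrite /crosses addbC; case: (boolP (_ (+) _)) => //= flip.
by rewrite (same_side (upper_flip dp dpq flip) dpq).
Qed.

(** Negation exchanges the two halves of the x-axis, and a step that changes [upper] crosses exactly
    one of them. *)
Lemma crossesN d p q : 0 < d -> d <= `|p| -> d <= `|q| -> `|p - q| < d ->
  crosses (- p) (- q) = crosses p q (+) (upper p (+) upper q).
Proof.
move=> d0 dp dq dpq.
have nz r : d <= `|r| -> r != 0 by rewrite -normr_gt0; exact: lt_le_trans.
rewrite /crosses !upperN ?nz // addbN addNb negbK.
case: (boolP (_ (+) _)) => //= flip.
have := upper_flip dp dpq flip; rewrite oppr_gt0 ler_normr => h.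
by rewrite addbT; case: (ltrgtP p.1 0) => //= h1; exfalso; lra.
Qed.

(** If [upper] changes between p and another corner, all corners lie on the same side of the y-axis
    and the sum telescopes; otherwise [upper] is constant. *)
Lemma crosses_cell d p q r x :
    d <= `|p| -> d <= `|q| -> d <= `|r| ->
    `|p - q| < d -> `|p - r| < d -> `|p - x| < d ->
    `|q - r| < d -> `|r - x| < d ->
  crosses p q (+) crosses q r (+) crosses r x (+) crosses p x = false.
Proof.
move=> dp dq dr pq pr px qr rx; rewrite /crosses.
have sameq := fun h => same_side h pq.
have samer := fun h => same_side h pr.
have samex := fun h => same_side h px.
case/orP: (orbN (upper p (+) upper q)) => [/(upper_flip dp pq) h|].
  rewrite -(sameq h) -(samer h); case: (0 < p.1); rewrite ?andbF ?andbT //.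
  by move: (upper p) (upper q) (upper r) (upper x); do 4!case.
case/orP: (orbN (upper p (+) upper r)) => [/(upper_flip dp pr) h|].
  rewrite -(sameq h) -(samer h); case: (0 < p.1); rewrite ?andbF ?andbT //.
  by move: (upper p) (upper q) (upper r) (upper x); do 4!case.
case/orP: (orbN (upper p (+) upper x)) => [/(upper_flip dp px) h|].
  rewrite -(sameq h) -(samer h); case: (0 < p.1); rewrite ?andbF ?andbT //.
  by move: (upper p) (upper q) (upper r) (upper x); do 4!case.
by move: (upper p) (upper q) (upper r) (upper x); do 4!case.
Qed.

Fixpoint crossings x s y : bool :=
  if s is x' :: s' then crosses (x - y) (x' - y) (+) crossings x' s' y
  else false.

Definition nearby d x y := `|x - y| < d.

(** Each step of the chain adds a cell with corners x - y, x' - y, x' - y', x - y'. Its sides are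
    shorter than d and its diagonal shorter than d + d, hence the bound on the distances. *)
Lemma crossings_strip d x s y y' :
    path (nearby d) x s -> `|y - y'| < d ->
    (forall z, z \in x :: s -> d + d <= `|z - y|) ->
    (forall z, z \in x :: s -> d + d <= `|z - y'|) ->
  crossings x s y (+) crossings x s y' (+)
    crosses (x - y) (x - y') (+) crosses (last x s - y) (last x s - y') = false.
Proof.
move=> + dy; elim: s x => [|x' s IHs] x /=; first by rewrite addbb.
case/andP => dx /IHs {}IHs far far'.
have d0 : 0 < d by apply: le_lt_trans dx.
have {IHs} := IHs (fun z hz => far z (@mem_behead _ (_ :: _) z hz))
  (fun z hz => far' z (@mem_behead _ (_ :: _) z hz)).
have dd : d < d + d by rewrite ltrDl.
have sx z : x - z - (x' - z) = x - x' by rewrite subrACA subrr subr0.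
have sy z : z - y - (z - y') = - (y - y') by rewrite subrACA subrr sub0r.
have farx := far x (mem_head _ _); have farx' := far' x (mem_head _ _).
have fx' : x' \in x :: x' :: s by rewrite !inE eqxx orbT.
have := @crosses_cell (d + d) (x - y) (x' - y) (x' - y') (x - y') farx
  (far _ fx') (far' _ fx').
rewrite sx sy normrN (lt_trans dx dd) (lt_trans dy dd) subrACA.
rewrite (le_lt_trans (ler_normB _ _) (ltrD dx dy)) sy normrN (lt_trans dy dd).
rewrite -opprB sx normrN (lt_trans dx dd) => /(_ isT isT isT isT isT).
rewrite (@crossesC (d + d) (x - y') (x' - y')) //; last first.
  by rewrite sx (lt_trans dx dd).
case: crosses; case: crosses; case: crosses; case: crosses; case: crosses;
  by case: crossings; case: crossings.
Qed.

(** Strips are stacked along the second chain. At both ends of a strip, [crossesN] turns a crossing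
    by z - y into one by y - z, which leaves the [upper] terms at the corners. *)
Lemma crossings_square d x s y t :
    path (nearby d) x s -> path (nearby d) y t ->
    (forall z w, z \in x :: s -> w \in y :: t -> d + d <= `|z - w|) ->
  crossings x s y (+) crossings x s (last y t) (+)
    crossings y t x (+) crossings y t (last x s) (+)
    upper (x - y) (+) upper (x - last y t) (+)
    upper (last x s - y) (+) upper (last x s - last y t) = false.
Proof.
move=> ps; elim: t y => [|y' t IHt] y /=.
  by move=> _ _; rewrite addbb; case: upper; case: upper.
case/andP => dy pt far.
have d0 : 0 < d by apply: le_lt_trans dy.
have dd : d < d + d by rewrite ltrDl.
have {IHt pt} := IHt _ pt (fun z w hz hw => far z w hz (@mem_behead _ (_ :: _) w hw)).
have fy' : y' \in y :: y' :: t by rewrite !inE eqxx orbT.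
have := crossings_strip ps dy (fun z hz => far z y hz (mem_head _ _))
  (fun z hz => far z y' hz fy').
have flip z : z \in x :: s ->
    crosses (y - z) (y' - z) =
    crosses (z - y) (z - y') (+) (upper (z - y) (+) upper (z - y')).
  move=> hz; rewrite -(opprB z) -(opprB z y') (@crossesN (d + d)) //.
  - by rewrite addr_gt0.
  - exact: far (mem_head _ _).
  - exact: far.
  - by rewrite subrACA subrr sub0r normrN (lt_trans dy).
rewrite (flip _ (mem_head _ _)) (flip _ (mem_last _ _)).
move: (crosses _ _) (crosses _ _) (crossings _ _ _) (crossings _ _ _).
move: (crossings _ _ _) (crossings _ _ _) (crossings _ _ _).
move: (upper _) (upper _) (upper _) (upper _) (upper _) (upper _).
by do 13!case.
Qed.

End Crossings.

(** * Compact connected sets in the plane *)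

Section Continua.
Variable R : realType.
Implicit Types (K L : set (plane R)) (x y z : plane R) (d : R).

Definition continuum K := compact K /\ connected K.

(** The points of K that such chains reach form a nonempty, relatively open and closed subset of
    K. *)
Lemma connected_chain K d x y : connected K -> 0 < d -> K x -> K y ->
  exists s, [/\ path (nearby d) x s, last x s = y
    & forall z, z \in x :: s -> K z].
Proof.
move=> cK d0 Kx Ky.
pose chained z := exists s, [/\ path (nearby d) x s, last x s = z
  & forall w, w \in x :: s -> K w].
have chained_step z w : K w -> `|z - w| < d -> chained z -> chained w.
  move=> Kw zw [s [ps lz sK]]; exists (rcons s w); split.
  - by rewrite rcons_path ps lz /nearby.
  - by rewrite last_rcons.
  - move=> v; rewrite -rcons_cons mem_rcons inE => /orP [/eqP ->//|].
    exact: sK.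
suff h : K `&` chained = K.
  by have [_] : (K `&` chained) y by rewrite h.
apply: cK.
- exists x; split=> //; exists [::]; split=> // w.
  by rewrite inE => /eqP ->.
- exists (\bigcup_(z in K `&` chained) ball z d).
    by apply: bigcup_open => z _; exact: ball_open.
  apply/seteqP; split=> z [Kz].
    by move=> cz; split=> //; exists z => //; exact: ballxx.
  move=> [w [Kw cw]]; rewrite -ball_normE /= => wz; split=> //.
  exact: chained_step cw.
- exists (~` \bigcup_(z in K `&` ~` chained) ball z d).
    apply: open_closedC.
    by apply: bigcup_open => z _; exact: ball_open.
  apply/seteqP; split=> z [Kz].
    move=> cz; split=> // -[w [Kw ncw]]; rewrite -ball_normE /= => wz.
    by apply: ncw; apply: chained_step cz => //; rewrite distrC.
  move=> h; split=> //; apply: contrapT => nc; apply: h.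
  by exists z => //; exact: ballxx.
Qed.

(** Each point of K has a ball of some radius e that misses L; points of the ball of half that
    radius are at least e / 2 away from L, and compactness makes the bound uniform. Stating it for
    all small d lets finitely many pairs share one d. *)
Lemma compact_gap K L : compact K -> closed L -> K `&` L = set0 ->
  \forall d \near 0^'+, forall x y, K x -> L y -> d <= `|x - y|.
Proof.
move=> /compact_near_coveringP cK cL KL.
suff : \forall d \near 0^'+, K `<=` [set x | forall y, L y -> d <= `|x - y|].
  by apply: filterS => d h x y /h; exact.
apply: cK => x Kx.
have /nbhs_ballP [e /= e0 xe] : nbhs x (~` L).
  apply: open_nbhs_nbhs; split; first exact: closed_openC.
  by move=> Lx; have : (K `&` L) x by []; rewrite KL.
have e2 : 0 < e / 2 by rewrite divr_gt0.
exists (ball x (e / 2), [set d | d < e / 2]) => /=.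
  split; first exact: nbhsx_ballx.
  exact: nbhs_right_lt.
case=> x' d [/= + de] y Ly; rewrite -ball_normE /= => xx'.
rewrite leNgt; apply/negP => x'y; apply: (xe y) => //.
rewrite -ball_normE /=.
rewrite (_ : x - y = (x - x') + (x' - y)); last by rewrite addrA subrK.
rewrite (splitr e) (le_lt_trans (ler_normD _ _)) // ltrD //.
exact: lt_trans de.
Qed.

(* [cr e y] counts, modulo 2, the crossings of the rightward horizontal ray from
   y with a fine chain chosen in [K e]; the [upper] terms convert crossings by
   x - f, on the sides x * f of the square, into crossings by f - x. *)
Lemma crossing_parity (E : finType) (K : E -> set (plane R))
    (s t : E -> plane R) :
    (forall e, continuum (K e)) -> (forall e, K e (s e)) ->
    (forall e, K e (t e)) ->
  exists cr : E -> plane R -> bool, forall e f, K e `&` K f = set0 ->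
    cr e (s f) (+) cr e (t f) (+) cr f (s e) (+) cr f (t e) (+)
    upper (s e - s f) (+) upper (s e - t f) (+)
    upper (t e - s f) (+) upper (t e - t f) = false.
Proof.
move=> cK Ks Kt.
have gap : \forall d \near (0 : R)^'+, forall e f, K e `&` K f = set0 ->
    forall x y, K e x -> K f y -> d <= `|x - y|.
  apply: filter_forall => e; apply: filter_forall => f.
  have [KK|nKK] := pselect (K e `&` K f = set0).
    have cKf : closed (K f).
      by apply: compact_closed; [exact: norm_hausdorff|case: (cK f)].
    by have := compact_gap (cK e).1 cKf KK; apply: filterS => d h _.
  by near=> d => KK.
have [d [/= d0 gapd]] : exists d : R, 0 < d /\ forall e f,
    K e `&` K f = set0 -> forall x y, K e x -> K f y -> d <= `|x - y|.
  apply: (@filter_ex _ (0 : R)^'+).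
  by apply: filterI; [exact: nbhs_right_gt|exact: gap].
(* Steps stay below half the common gap because [crossings_square] asks for a distance of twice the
   step. *)
have d2 : 0 < d / 2 by rewrite divr_gt0.
have ch e := connected_chain (cK e).2 d2 (Ks e) (Kt e).
have {ch} [c chain] := choice ch.
exists (fun e => crossings (s e) (c e)) => e f KK.
have [pe le Ke] := chain e; have [pf lf Kf] := chain f.
rewrite -lf -le.
apply: crossings_square pe pf _ => z w hz hw.
by rewrite -splitr; apply: (gapd e f KK); [exact: Ke|exact: Kf].
Unshelve. all: by end_near.
Qed.

Lemma continuumU K L : K `&` L !=set0 -> continuum K -> continuum L ->
  continuum (K `|` L).
Proof.
by move=> KL [cK oK] [cL oL]; split; [exact: compactU|exact: connectedU].
Qed.

Lemma continuum1 x : continuum [set x].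
Proof. by split; [exact: compact_set1|exact: connected1]. Qed.

Lemma continuum_image (f : R -> plane R) :
  {within `[0, 1], continuous f} -> continuum (f @` `[0, 1]).
Proof.
move=> cf; split.
  by apply: continuous_compact => //; exact: segment_compact.
by apply: connected_continuous_connected => //; exact: segment_connected.
Qed.

Lemma arc_continuum K x y : is_arc K x y -> [/\ continuum K, K x & K y].
Proof.
case=> f [cf _ f0 f1 <-]; split; first exact: continuum_image.
  by exists 0; rewrite //= in_itv /= lexx ler01.
by exists 1; rewrite //= in_itv /= lexx ler01.
Qed.

Definition segment x y := [set x + t *: (y - x) | t in `[0, 1]].

Lemma segment_path_continuous x y :
  {within `[0, 1], continuous (fun t : R => x + t *: (y - x) : plane R)}.
Proof.
apply: continuous_subspaceT => t; apply: cvgD; first exact: cvg_cst.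
by apply: cvgZr_tmp; exact: cvg_id.
Qed.

Lemma segment_continuum x y : [/\ continuum (segment x y), segment x y x
  & segment x y y].
Proof.
split; first exact/continuum_image/segment_path_continuous.
  by exists 0; rewrite /= ?in_itv /= ?lexx ?ler01 // scale0r addr0.
by exists 1; rewrite /= ?in_itv /= ?lexx ?ler01 // scale1r addrC subrK.
Qed.

Lemma segment_ball x y d : `|x - y| < d -> segment x y `<=` ball x d.
Proof.
move=> xy z [t /=]; rewrite in_itv /= => /andP [t0 t1] <-.
rewrite -ball_normE /= opprD addrA subrr sub0r normrN normrZ ger0_norm //.
by apply: le_lt_trans xy; rewrite distrC ler_piMl.
Qed.

End Continua.

(** * Nonplanarity of K33 and K5 *)

(** Converts to the operation that [Btauto] handles. *)
Lemma addb_xorb (b c : bool) : b (+) c = xorb b c.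
Proof. by case: b c => [] []. Qed.

Lemma addb_false (b c : bool) : b = false -> c = false -> b (+) c = false.
Proof. by move=> -> ->. Qed.

Section Kuratowski.
Variable R : realType.

Lemma no_K33 (A B : finType) (a : A -> plane R) (b : B -> plane R)
    (K : A -> B -> set (plane R)) (i0 i1 i2 : A) (j0 j1 j2 : B) :
    uniq [:: i0; i1; i2] -> uniq [:: j0; j1; j2] ->
    (forall i j, [/\ continuum (K i j), K i j (a i) & K i j (b j)]) ->
    (forall i i' j j', i != i' -> j != j' -> K i j `&` K i' j' = set0) ->
  False.
Proof.
move=> ui uj hK dK.
have [cr par] := @crossing_parity R (A * B)%type (fun e => K e.1 e.2)
  (fun e => a e.1) (fun e => b e.2) (fun e => let: And3 h _ _ := hK e.1 e.2 in h)
  (fun e => let: And3 _ h _ := hK e.1 e.2 in h)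
  (fun e => let: And3 _ _ h := hK e.1 e.2 in h).
(* Summing the relations over the pairs j != j' for fixed i != i' leaves
   X i + X i' = 1, which cannot hold for all three pairs {i, i'}. *)
pose X i := cr (i, j0) (b j1) (+) cr (i, j0) (b j2) (+) cr (i, j1) (b j0) (+)
  cr (i, j1) (b j2) (+) cr (i, j2) (b j0) (+) cr (i, j2) (b j1).
(* The two points lie on disjoint edges, hence are distinct, so reversing their difference changes
   [upper]. *)
have ab (i i' : A) (j j' : B) : i != i' -> j != j' ->
    upper (b j - a i') = ~~ upper (a i' - b j).
  move=> ii jj; rewrite -opprB upperN // subr_eq0; apply/eqP => e.
  have : (K i j `&` K i' j') (b j).
    by split; [case: (hK i j)|rewrite -e; case: (hK i' j')].
  by rewrite dK.
have bb (i i' : A) (j j' : B) : i != i' -> j != j' ->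
    upper (b j' - b j) = ~~ upper (b j - b j').
  move=> ii jj; rewrite -opprB upperN // subr_eq0; apply/eqP => e.
  have : (K i j `&` K i' j') (b j).
    by split; [case: (hK i j)|rewrite e; case: (hK i' j')].
  by rewrite dK.
have XX (i i' : A) : i != i' -> X i (+) X i'.
  move=> ii.
  have eqn (j j' : B) : j != j' ->
      cr (i, j) (a i') (+) cr (i, j) (b j') (+) cr (i', j') (a i) (+)
      cr (i', j') (b j) (+) upper (a i - a i') (+) upper (a i - b j') (+)
      ~~ upper (a i' - b j) (+) upper (b j - b j') = false.
    by move=> jj; rewrite -(ab i i' j j') // -(par (i, j) (i', j')) //= dK.
  move: uj; rewrite /= !inE !negb_or => /and3P [/andP [j01 j02] j12 _].
  have e01 := eqn _ _ j01; have e02 := eqn _ _ j02; have e12 := eqn _ _ j12.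
  rewrite eq_sym in j01; rewrite eq_sym in j02; rewrite eq_sym in j12.
  have e10 := eqn _ _ j01; have e20 := eqn _ _ j02; have e21 := eqn _ _ j12.
  (* In the sum over the six ordered pairs every term occurs an even number of times, except those
     of X and the differences b j - b j'; the latter form three opposite pairs, each adding 1. *)
  have := addb_false e01 (addb_false e02 (addb_false e12
    (addb_false e10 (addb_false e20 e21)))).
  rewrite (bb _ _ _ _ ii j01) (bb _ _ _ _ ii j02) (bb _ _ _ _ ii j12) /X => e.
  by apply/negbFE; rewrite -e !addb_xorb; Btauto.btauto.
move: ui; rewrite /= !inE !negb_or => /and3P [/andP [i01 i02] i12 _].
have := XX _ _ i01; have := XX _ _ i02; have := XX _ _ i12.
by case: (X i0); case: (X i1); case: (X i2).
Qed.

Lemma no_K5 (V : finType) (a : V -> plane R) (K : V -> V -> set (plane R))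
    (i0 i1 i2 i3 i4 : V) :
    uniq [:: i0; i1; i2; i3; i4] ->
    (forall i j, [/\ continuum (K i j), K i j (a i) & K i j (a j)]) ->
    (forall i j k l, uniq [:: i; j; k; l] -> K i j `&` K k l = set0) ->
  False.
Proof.
move=> ui hK dK.
have [cr par] := @crossing_parity R (V * V)%type (fun e => K e.1 e.2)
  (fun e => a e.1) (fun e => a e.2) (fun e => let: And3 h _ _ := hK e.1 e.2 in h)
  (fun e => let: And3 _ h _ := hK e.1 e.2 in h)
  (fun e => let: And3 _ _ h := hK e.1 e.2 in h).
have anti i j k l : uniq [:: i; j; k; l] ->
    upper (a k - a i) = ~~ upper (a i - a k).
  move=> u; rewrite -opprB upperN // subr_eq0; apply/eqP => e.
  have : (K i j `&` K k l) (a i).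
    by split; [case: (hK i j)|rewrite e; case: (hK k l)].
  by rewrite dK.
(* The three relations on four vertices make the sum of Y over the four triples
   odd; but each triple lies in two of the five 4-sets. *)
pose Y i j k := cr (i, j) (a k) (+) cr (i, k) (a j) (+) cr (j, k) (a i).
have YY i j k l : uniq [:: i; j; k; l] ->
    Y i j k (+) Y i j l (+) Y i k l (+) Y j k l.
  move=> u.
  have u' : uniq [:: i; k; j; l].
    by move: u; rewrite (@perm_uniq _ _ [:: i; k; j; l]) //; apply/permP => p /=; lia.
  have u'' : uniq [:: i; l; j; k].
    by move: u; rewrite (@perm_uniq _ _ [:: i; l; j; k]) //; apply/permP => p /=; lia.
  have v : uniq [:: j; i; k; l].
    by move: u; rewrite (@perm_uniq _ _ [:: j; i; k; l]) //; apply/permP => p /=; lia.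
  have v' : uniq [:: j; i; l; k].
    by move: u; rewrite (@perm_uniq _ _ [:: j; i; l; k]) //; apply/permP => p /=; lia.
  have v'' : uniq [:: k; i; l; j].
    by move: u; rewrite (@perm_uniq _ _ [:: k; i; l; j]) //; apply/permP => p /=; lia.
  (* Four vertices split into two edges in three ways. The differences starting at a i cancel in the
     sum, and each pair among j, k, l occurs in both directions and adds 1. *)
  have := addb_false (par (i, j) (k, l) (dK _ _ _ _ u)) (addb_false
    (par (i, k) (j, l) (dK _ _ _ _ u')) (par (i, l) (j, k) (dK _ _ _ _ u''))).
  rewrite /= (anti _ _ _ _ v) (anti _ _ _ _ v') (anti _ _ _ _ v'') /Y => e.
  by apply/negbFE; rewrite -e !addb_xorb; Btauto.btauto.
have := YY _ _ _ _ (mask_uniq ui [:: true; true; true; true]).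
have := YY _ _ _ _ (mask_uniq ui [:: true; true; true; false; true]).
have := YY _ _ _ _ (mask_uniq ui [:: true; true; false; true; true]).
have := YY _ _ _ _ (mask_uniq ui [:: true; false; true; true; true]).
have := YY _ _ _ _ (mask_uniq ui [:: false; true; true; true; true]).
move: (Y i0 i1 i2) (Y i0 i1 i3) (Y i0 i1 i4) (Y i0 i2 i3) (Y i0 i2 i4).
move: (Y i0 i3 i4) (Y i1 i2 i3) (Y i1 i2 i4) (Y i1 i3 i4) (Y i2 i3 i4).
by do 10!case.
Qed.

End Kuratowski.

(** * Joining a point of a face to the vertices *)

(** The points that continua off D join to p form an open and closed part of the component: inside a
    ball that misses the closed set D, a segment extends the continuum. *)
Lemma component_continuum (R : realType) (D : set (plane R)) (p q : plane R) :
    closed D -> ~ D p -> connected_component (~` D) p q ->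
  exists K, [/\ continuum K, K p, K q & K `<=` ~` D].
Proof.
move=> cD nDp Cq; set C := connected_component _ _ in Cq.
pose joined z := exists K, [/\ continuum K, K p, K z & K `<=` ~` D].
have CD : C `<=` ~` D by exact: connected_component_sub.
have room z : (~` D) z -> exists2 e : R, 0 < e & ball z e `<=` ~` D.
  by move=> nDz; apply/nbhs_ballP/open_nbhs_nbhs; split => //; apply: closed_openC.
have step z w e : ball z e `<=` ~` D -> ball z e w -> joined z -> joined w.
  move=> zD zw [K [cK Kp Kz KD]].
  have [cs sz sw] := segment_continuum z w.
  exists (K `|` segment z w); split.
  - by apply: continuumU => //; exists z.
  - by left.
  - by right.
  - move=> v [/KD //|] /(@segment_ball _ z w e); rewrite -ball_normE /= in zw.
    by move=> /(_ zw); apply: zD.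
suff h : C `&` joined = C by have [] : (C `&` joined) q by rewrite h.
apply: (component_connected (x := p)).
- exists p; split; first exact: connected_component_refl.
  exists [set p]; split => //; first exact: continuum1.
  by move=> z ->; exact: nDp.
- exists joined => //; rewrite openE => z jz.
  have [K [_ _ Kz KD]] := jz; have [e e0 he] := room z (KD _ Kz).
  apply/nbhs_ballP; exists e => // w zw; exact: (step z w e).
- exists (~` [set z | ~ D z /\ ~ joined z]).
    apply: open_closedC; rewrite openE => z [nDz njz].
    have [e e0 he] := room z nDz.
    have e2 : 0 < e / 2 by rewrite divr_gt0.
    apply/nbhs_ballP; exists (e / 2) => // w zw; split.
      by apply: he; apply: le_ball zw; rewrite ler_pdivrMr // ler_peMr ?ler1n // ltW.
    move=> jw; apply: njz; apply: (step w z (e / 2)) jw; last exact: ball_sym.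
    move=> v wv; apply: he; rewrite (splitr e); exact: ball_triangle wv.
  apply/seteqP; split=> z [Cz].
    by move=> jz; split=> // -[_].
  by move=> h; split => //; apply: contrapT => njz; apply: h; split=> //; apply: CD.
Qed.

(** * Walks inside a vertex set *)

Inductive joined (G : sgraph) (S : set G) : G -> G -> Prop :=
| joined_refl x : S x -> joined S x x
| joined_step x y z : adj x y -> S x -> joined S y z -> joined S x z.

Section Joined.
Variable G : sgraph.
Implicit Types (S : set G) (x y z : G).

Lemma joined_ends S x y : joined S x y -> S x /\ S y.
Proof. by elim=> {x y} [x Sx //|x y z _ Sx _ [_ Sz]]. Qed.

Lemma joined_edge S x y : adj x y -> S x -> S y -> joined S x y.
Proof. by move=> xy Sx Sy; apply: joined_step xy Sx (joined_refl Sy). Qed.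

Lemma joined_trans S x y z : joined S x y -> joined S y z -> joined S x z.
Proof. by elim=> {x y} [//|x y w xy Sx _ IH /IH]; exact: joined_step. Qed.

Lemma joined_sym S x y : joined S x y -> joined S y x.
Proof.
elim=> {x y} [x Sx|x y z xy Sx yz zy]; first exact: joined_refl.
apply: joined_trans zy _; apply: joined_edge => //; first by rewrite adj_sym.
by case: (joined_ends yz).
Qed.

End Joined.

(** * Drawings of induced subgraphs *)

Section Embedding.
Variables (R : realType) (G : sgraph) (pos : G -> plane R).
Variable curve : G -> G -> set (plane R).
Hypothesis emb : planar_embedding pos curve.
Implicit Types (S T : set G) (x y z : G).

Definition drawn S : set (plane R) :=
  pos @` S `|` [set p | exists x y, [/\ adj x y, S x, S y & curve x y p]].

Lemma drawn_mono S T : S `<=` T -> drawn S `<=` drawn T.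
Proof.
move=> ST p [[x Sx <-]|[x [y [xy Sx Sy p_]]]]; first by left; exists x; auto.
by right; exists x, y; split; auto.
Qed.

Lemma drawn_setT : drawn setT = drawing pos curve.
Proof.
apply/seteqP; split=> p [?|]; try by left.
  by move=> [x [y [xy _ _ pxy]]]; right; exists x, y.
by move=> [x [y [xy pxy]]]; right; exists x, y.
Qed.

Lemma drawn_pos S x : drawn S (pos x) -> S x.
Proof.
case=> [[y Sy /(pos_inj emb) <- //]|[y [z [yz Sy Sz]]]].
by move=> /(curve_vertex emb yz) [] ->.
Qed.

(** Edges within disjoint vertex sets are distinct, so a common point is a vertex, which [drawn_pos]
    places in both sets. *)
Lemma drawn_disjoint S T : S `&` T = set0 -> drawn S `&` drawn T = set0.
Proof.
move=> ST; rewrite -subset0 => p [Sp Tp].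
have contra x : S x -> T x -> False by move=> Sx Tx; rewrite -[False]/(set0 x) -ST.
suff [x _ px] : range pos p.
  by move: Sp Tp; rewrite -px => /drawn_pos Sx /drawn_pos; exact: contra.
case: Sp => [[x _ <-]|[x [y [xy Sx Sy pxy]]]]; first by exists x.
case: Tp => [[z _ <-]|[z [w [zw Tz Tw pzw]]]]; first by exists z.
apply: (curve_disjoint emb xy zw) => //.
apply/eqP => /setP /(_ x); rewrite !inE eqxx /=.
by move=> /esym /orP [] /eqP xz; move: Sx; rewrite xz => /contra; exact.
Qed.

Lemma drawn_closed S : closed (drawn S).
Proof.
have -> : drawn S = \bigcup_(x in S) [set pos x] `|`
    \bigcup_(e in [set e : G * G | [/\ adj e.1 e.2, S e.1 & S e.2]])
      curve e.1 e.2.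
  apply/seteqP; split=> p.
    case=> [[x Sx <-]|[x [y [xy Sx Sy pxy]]]]; first by left; exists x.
    by right; exists (x, y).
  case=> [[x Sx ->]|[[x y] [/= xy Sx Sy] pxy]]; first by left; exists x.
  by right; exists x, y.
have haus : hausdorff_space (plane R) by exact: norm_hausdorff.
apply: closedU; apply: closed_bigcup; try exact: finite_finset.
- move=> x _; exact/accessible_closed_set1/hausdorff_accessible.
- move=> [x y] [/= xy _ _]; apply: compact_closed => //.
  by have [[]] := arc_continuum (curve_arc emb xy).
Qed.

Lemma joined_continuum S x y : joined S x y ->
  exists K, [/\ continuum K, K (pos x), K (pos y) & K `<=` drawn S].
Proof.
elim=> {x y} [x Sx|x y z xy Sx yz [K [cK Ky Kz KS]]].
  exists [set pos x]; split=> // [|p ->]; first exact: continuum1.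
  by left; exists x.
have [ca ax ay] := arc_continuum (curve_arc emb xy).
exists (curve x y `|` K); split; [|by left|by right|].
  by apply: continuumU => //; exists (pos y).
move=> p [pxy|/KS //]; right; exists x, y; split=> //.
by case: (joined_ends yz).
Qed.

(* W x may meet the edges at x; only independent edges matter later. *)
Lemma apex F : is_face (drawing pos curve) F -> (forall x, closure F (pos x)) ->
  exists p0 W, forall x,
    [/\ continuum (W x), W x p0, W x (pos x)
      & W x `&` drawn (~` [set x]) = set0].
Proof.
move=> [p0 np0 ->] clF; exists p0; rewrite -drawn_setT in clF np0 *.
suff : forall x, exists K, [/\ continuum K, K p0, K (pos x)
    & K `&` drawn (~` [set x]) = set0] by move=> h; have [W hW] := choice h; exists W => x; exact: hW.
move=> x; set C := drawn _.
have nCx : (~` C) (pos x) by move=> /drawn_pos; apply.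
(* The last stretch, from a point q of the face to x, runs in a ball about x that misses every edge
   not incident to x. *)
have /nbhs_ballP [e /= e0 he] : nbhs (pos x) (~` C).
  by apply: open_nbhs_nbhs; split=> //; exact/closed_openC/drawn_closed.
have [q [Fq qx]] := clF x _ (nbhsx_ballx (pos x) e e0).
have [K [cK Kp Kq KD]] := component_continuum (@drawn_closed _) np0 Fq.
have [cs sx sq] := segment_continuum (pos x) q.
exists (K `|` segment (pos x) q); split; [|by left|by right|].
  by apply: continuumU => //; exists q.
rewrite -subset0 => p [[/KD Kp' /(drawn_mono (@subsetT _ _)) //|sp] Cp].
apply: he Cp; apply: segment_ball sp.
by move: qx; rewrite -ball_normE.
Qed.

End Embedding.

(** * Subdivisions of K_{2,3} and K_4 in outerplanar graphs *)

Section Obstructions.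
Variables (R : realType) (G : sgraph).
Hypothesis outer : outerplanar R G.

(** The point p0 of the face, joined to each [y j] by [W], acts as a third vertex beside the two
    [x i] and completes a K_{3,3}. [S i j] holds the vertices of the path that represents an
    edge. *)
Lemma outerplanar_no_K23 (x : bool -> G) (y : option bool -> G)
    (S : bool -> option bool -> set G) :
    (forall i j, joined (S i j) (x i) (y j)) ->
    (forall i j j', j != j' -> S i j `&` S (~~ i) j' = set0) ->
  False.
Proof.
move=> jS dS; have [pos [curve [emb [F [[faceF _] clF]]]]] := outer.
have [p0 [W hW]] := apex emb faceF clF.
have [K hK] := choice (fun e => joined_continuum emb (jS e.1 e.2)).
(* [y j] lies in [S (~~ i) j], hence not in [S i j'], and [W (y j)] avoids whatever is drawn without
   [y j]. *)
have WK j i j' : j != j' -> W (y j) `&` K (i, j') = set0.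
  move=> jj; have [_ _ _ disj] := hW (y j); rewrite -subset0 -disj => p [Wp Kp].
  have [_ _ _ /(_ _ Kp) dp] := hK (i, j'); split=> //; apply: drawn_mono dp => z Sz zy.
  rewrite -[False]/(set0 z) -(dS i j' j) 1?eq_sym //; split=> //; rewrite zy.
  by have [] := joined_ends (jS (~~ i) j).
apply: (@no_K33 R (option bool) (option bool)
  (fun i => if i is Some i' then pos (x i') else p0) (fun j => pos (y j))
  (fun i j => if i is Some i' then K (i', j) else W (y j))
  None (Some true) (Some false) None (Some true) (Some false)) => //.
- by move=> [i|] j; [have [] := hK (i, j)|have [] := hW (y j)].
- move=> [i|] [i'|] j j' // ii jj.
  + rewrite -subset0; have [_ _ _ s] := hK (i, j); have [_ _ _ s'] := hK (i', j').
    apply: subset_trans (setISS s s') _; rewrite drawn_disjoint //=.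
    by rewrite (_ : i' = ~~ i) ?dS //; move: ii; clear; case: i i' => [] [].
  + by rewrite setIC WK // eq_sym.
  + by rewrite WK.
Qed.

(** The point p0, joined to all four branch vertices by [W], becomes the fifth vertex of a K_5. *)
Lemma outerplanar_no_K4 (x : bool * bool -> G)
    (S : bool * bool -> bool * bool -> set G) :
    (forall i j, joined (S i j) (x i) (x j)) ->
    (forall i j k l, uniq [:: i; j; k; l] -> S i j `&` S k l = set0) ->
  False.
Proof.
move=> jS dS; have [pos [curve [emb [F [[faceF _] clF]]]]] := outer.
have [p0 [W hW]] := apex emb faceF clF.
have [K hK] := choice (fun e => joined_continuum emb (jS e.1 e.2)).
have WK i k l : uniq [:: i; k; l] -> W (x i) `&` K (k, l) = set0.
  (* A fourth index j puts [x i] into a set [S i j] that is disjoint from [S k l]. *)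
  move=> u; have [j uj] : exists j, uniq [:: i; j; k; l].
    case: i k l u => [[] []] [[] []] [[] []] // _;
    by [exists (true, true)|exists (true, false)|exists (false, true)|exists (false, false)].
  have [_ _ _ disj] := hW (x i); rewrite -subset0 -disj => p [Wp Kp].
  have [_ _ _ /(_ _ Kp) dp] := hK (k, l); split=> //; apply: drawn_mono dp => z Sz zy.
  rewrite -[False]/(set0 z) -(dS _ _ _ _ uj) //; split=> //; rewrite zy.
  by have [] := joined_ends (jS i j).
apply: (@no_K5 R (option (bool * bool))
  (fun i => if i is Some i' then pos (x i') else p0)
  (fun i j => match i, j with
    | Some i', Some j' => K (i', j')
    | Some i', None => W (x i')
    | None, Some j' => W (x j')
    (* A default containing p0; the pair occurs in no two independent edges. *)
    | None, None => [set p0]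
    end)
  None (Some (true, true)) (Some (true, false)) (Some (false, true))
  (Some (false, false))) => //.
- move=> [i|] [j|].
  + by have [] := hK (i, j).
  + by have [] := hW (x i).
  + by have [] := hW (x j).
  + by split=> //; exact: continuum1.
- move=> i j k l u.
  have us (s : seq (bool * bool)) : uniq (map Some s) -> uniq s.
    by rewrite map_inj_uniq // => ? ? [].
  case: i j k l u => [i|] [j|] [k|] [l|] u; try by rewrite /= ?inE ?andbF in u.
  + rewrite -subset0.
    have [_ _ _ s] := hK (i, j); have [_ _ _ s'] := hK (k, l).
    apply: subset_trans (setISS s s') _.
    by rewrite drawn_disjoint // (dS _ _ _ _ (us [:: i; j; k; l] u)).
  + rewrite setIC WK // -(rot_uniq 1).
    exact: us [:: i; j; k] (mask_uniq u [:: true; true; true; false]).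
  + rewrite setIC WK // -(rot_uniq 1).
    exact: us [:: i; j; l] (mask_uniq u [:: true; true; false; true]).
  + rewrite WK //; exact: us [:: i; k; l] (mask_uniq u [:: true; false; true; true]).
  + rewrite WK //; exact: us [:: j; k; l] (mask_uniq u [:: false; true; true; true]).
Qed.

End Obstructions.

(** * Obstructions in ladders *)

Section Ladder.
Local Open Scope nat_scope.

Definition between (i k t : nat) : bool := minn i k <= t <= maxn i k.

Lemma joined_between (G : sgraph) (n : nat) (f : 'I_n -> G) (i k : 'I_n)
    (S : set G) :
    (forall s t : 'I_n, consecutive s t -> adj (f s) (f t)) ->
    (forall t : 'I_n, between i k t -> S (f t)) ->
  joined S (f i) (f k).
Proof.
move=> path_f; wlog ik : i k / i <= k => [th|].
  case: (leqP i k) => [/th //|/ltnW /th h hS]; apply: joined_sym; apply: h => t.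
  by rewrite /between minnC maxnC; exact: hS.
move=> hS.
suff join (t : nat) (tn : t < n) : i <= t <= k -> joined S (f i) (f (Ordinal tn)).
  have := join k (ltn_ord k); rewrite ik leqnn (_ : Ordinal _ = k) //.
    by apply.
  exact: val_inj.
elim: t tn => [|t IHt] tn itk.
  rewrite (_ : Ordinal tn = i); last by apply: val_inj => /=; lia.
  by apply/joined_refl/hS; rewrite /between; lia.
have [it|it] := eqVneq (i : nat) t.+1.
  rewrite (_ : Ordinal tn = i); last by apply: val_inj => /=; lia.
  by apply/joined_refl/hS; rewrite /between; lia.
have tn' : t < n by lia.
apply: joined_trans (IHt tn' _) _; first by lia.
apply: joined_edge; first by apply: path_f; rewrite /consecutive /=; lia.
  by apply: hS; rewrite /between /=; lia.
by apply: hS; rewrite /between /=; lia.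
Qed.

Lemma ladder_swap (m n : nat) (G : sgraph) (u : 'I_m -> G) (v : 'I_n -> G) :
  generalized_ladder u v -> generalized_ladder v u.
Proof.
case=> ui vi uv cov pu pv; split=> //.
- by move=> i j /esym; exact: uv.
- by move=> x; case: (cov x); [right|left].
Qed.

Section Theta.
Variables (R : realType) (m n : nat) (G : sgraph).
Variables (u : 'I_m -> G) (v : 'I_n -> G).
Hypotheses (ladder : generalized_ladder u v) (outer : outerplanar R G).

(** Predicates on [nat] reduce disjointness of such sets to arithmetic on indices. *)
Definition part (P Q : pred nat) : set G :=
  [set x | (exists2 i, P (nat_of_ord i) & x = u i) \/
           (exists2 j, Q (nat_of_ord j) & x = v j)].

Lemma part_disjoint (P Q P' Q' : pred nat) :
    (forall i, P i -> P' i -> False) -> (forall j, Q j -> Q' j -> False) ->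
  part P Q `&` part P' Q' = set0.
Proof.
move=> dP dQ; rewrite -subset0 => x [].
case=> [[i Pi ->]|[j Qj ->]] [[i' Pi']|[j' Qj']].
- by move=> /(ladder_u_inj ladder) ii'; apply: dP Pi _; rewrite ii'.
- exact: (ladder_disjoint ladder).
- by move=> /esym; exact: (ladder_disjoint ladder).
- by move=> /(ladder_v_inj ladder) jj'; apply: dQ Qj _; rewrite jj'.
Qed.

Lemma part_u (P Q : pred nat) (i k : 'I_m) :
  (forall t, between i k t -> P t) -> joined (part P Q) (u i) (u k).
Proof.
move=> hP; apply: joined_between => [s t|t /hP Pt].
  by rewrite (ladder_u_path ladder).
by left; exists t.
Qed.

Lemma part_v (P Q : pred nat) (j k : 'I_n) :
  (forall t, between j k t -> Q t) -> joined (part P Q) (v j) (v k).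
Proof.
move=> hQ; apply: joined_between => [s t|t /hQ Qt].
  by rewrite (ladder_v_path ladder).
by right; exists t.
Qed.

Lemma part_cross (P Q : pred nat) (i : 'I_m) (j : 'I_n) :
  adj (u i) (v j) -> P i -> Q j -> joined (part P Q) (u i) (v j).
Proof.
by move=> ij Pi Qj; apply: joined_edge => //; [left; exists i|right; exists j].
Qed.

(* The branch vertices are v_b and u_c, and the three paths between them pass
   through u_a, v_d and v_q. *)
Lemma ladder_no_theta (a c p : 'I_m) (b d q : 'I_n) :
    adj (u a) (v b) -> adj (u c) (v d) -> adj (u p) (v q) ->
    (a < c <= p) || (p <= c < a) -> (q < b < d) || (d < b < q) ->
  False.
Proof.
move=> ab cd pq acp qbd.
(* [true] stands for v_b and [false] for u_c; [None], [Some true], [Some false] stand for u_a, v_d,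
   v_q. The path from u_c to v_q follows the first path to u_p and then takes the edge to v_q. *)
pose P i (j : option bool) : pred nat := match i, j with
  | true, None => pred1 (a : nat)
  | true, Some _ => pred0
  | false, None => between a c
  | false, Some true => pred1 (c : nat)
  | false, Some false => between c p end.
pose Q i (j : option bool) : pred nat := match i, j with
  | true, None => pred1 (b : nat)
  | true, Some true => between b d
  | true, Some false => between b q
  | false, None => pred0
  | false, Some true => pred1 (d : nat)
  | false, Some false => pred1 (q : nat) end.
apply: (@outerplanar_no_K23 R G outer (fun i => if i then v b else u c)
  (fun j => match j with
    | None => u a | Some true => v d | Some false => v q end)
  (fun i j => part (P i j) (Q i j))).
- case=> [] [[]|].
  + exact: part_v.
  + exact: part_v.
  + by apply: joined_sym; apply: part_cross ab _ _ => /=.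
  + by apply: part_cross cd _ _ => /=.
  + have cpp : P false (Some false) p by rewrite /= /between; lia.
    by apply: joined_trans (part_cross pq cpp _); [exact: part_u|rewrite /=].
  + by apply: part_u => t; rewrite /= /between minnC maxnC.
- case=> [] [[]|] [[]|] // _; apply: part_disjoint => t; rewrite /= /between; lia.
Qed.

(** The four cross edges and the stretches of the two paths between their ends form a subdivision of
    K_4. *)
Lemma ladder_no_K4 (a c : 'I_m) (b d : 'I_n) : a < c -> b < d ->
    adj (u a) (v b) -> adj (u a) (v d) -> adj (u c) (v b) -> adj (u c) (v d) ->
  False.
Proof.
move=> ac bd ab ad cb cd.
(* In a branch vertex, coded by two bits, the first bit selects the path and the second the end on
   it. *)
pose i0 (t : bool) := if t then c else a; pose j0 (t : bool) := if t then d else b.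
pose P (p q : bool * bool) : pred nat := match p.1, q.1 with
  | true, true => pred0
  | true, false => pred1 (i0 q.2 : nat)
  | false, true => pred1 (i0 p.2 : nat)
  | false, false => between (i0 p.2) (i0 q.2) end.
pose Q (p q : bool * bool) : pred nat := match p.1, q.1 with
  | true, true => between (j0 p.2) (j0 q.2)
  | true, false => pred1 (j0 p.2 : nat)
  | false, true => pred1 (j0 q.2 : nat)
  | false, false => pred0 end.
have cross s t : adj (u (i0 s)) (v (j0 t)) by case: s t => [] [].
apply: (@outerplanar_no_K4 R G outer
  (fun p => if p.1 then v (j0 p.2) else u (i0 p.2))
  (fun p q => part (P p q) (Q p q))).
- move=> [[] s] [[] t] /=.
  + exact: part_v.
  + by apply: joined_sym; apply: part_cross (cross _ _) _ _; rewrite ?/P ?/Q /= eqxx.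
  + by apply: part_cross (cross _ _) _ _; rewrite ?/P ?/Q /= eqxx.
  + exact: part_u.
- move=> [[] s] [[] t] [[] s'] [[] t']; move: s t s' t';
  do 4!case; move=> //= _; apply: part_disjoint => i;
  rewrite /P /Q /i0 /j0 /= /between; lia.
Qed.

End Theta.

Section Mixed.
Variables (R : realType) (m n : nat) (G : sgraph).
Variables (u : 'I_m -> G) (v : 'I_n -> G).
Hypotheses (ladder : generalized_ladder u v) (outer : outerplanar R G).

(** On one path the ends of the two other edges are on the same side of the first edge, on the other
    path on opposite sides. The nearer end on the common side is a branch vertex for
    [ladder_no_theta], up to exchanging the paths. *)
Lemma ladder_no_mixed (a c p : 'I_m) (b d q : 'I_n) :
    adj (u a) (v b) -> adj (u c) (v d) -> adj (u p) (v q) ->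
    (a < c) && (b < d) || (c < a) && (d < b) ->
    (a < p) && (q < b) || (p < a) && (b < q) ->
  False.
Proof.
move=> ab cd pq inc dec.
have swap := ladder_no_theta (ladder_swap ladder) outer.
have [s1|s1] := boolP ((a < c <= p) || (p <= c < a)).
  by apply: (ladder_no_theta ladder outer ab cd pq) => //; lia.
have [s2|s2] := boolP ((a < p <= c) || (c <= p < a)).
  by apply: (ladder_no_theta ladder outer ab pq cd) => //; lia.
have [s3|s3] := boolP ((b < d <= q) || (q <= d < b)).
  by apply: (swap b d q a c p) => //; rewrite 1?adj_sym //; lia.
by apply: (swap b q d a p c) => //; rewrite 1?adj_sym //; lia.
Qed.

(** If both ends differ, the two edges themselves form an increasing or a decreasing pair, so one of
    them belongs to pairs of both kinds. *)
Lemma ladder_share (a c p r : 'I_m) (b d q s : 'I_n) :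
    adj (u a) (v b) -> adj (u c) (v d) -> adj (u p) (v q) -> adj (u r) (v s) ->
    (a < c) && (b < d) || (c < a) && (d < b) ->
    (p < r) && (s < q) || (r < p) && (q < s) ->
  a = p :> nat \/ b = q :> nat.
Proof.
move=> ab cd pq rs inc dec.
have [//|neq] := pselect (a = p :> nat \/ b = q :> nat); exfalso.
have [dec'|ndec] := boolP ((a < p) && (q < b) || (p < a) && (b < q)).
  exact: ladder_no_mixed ab cd pq inc dec'.
by apply: (ladder_no_mixed pq ab rs) => //; clear -neq ndec; lia.
Qed.

Lemma ladder_no_increasing_decreasing (a c p r : 'I_m) (b d q s : 'I_n) :
    adj (u a) (v b) -> adj (u c) (v d) -> a < c -> b < d ->
    adj (u p) (v q) -> adj (u r) (v s) -> p < r -> s < q ->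
  False.
Proof.
move=> ab cd ac bd pq rs pr sq.
have inc : (a < c) && (b < d) || (c < a) && (d < b) by rewrite ac bd.
have inc' : (c < a) && (d < b) || (a < c) && (b < d) by rewrite ac bd orbT.
have dec : (p < r) && (s < q) || (r < p) && (q < s) by rewrite pr sq.
have dec' : (r < p) && (q < s) || (p < r) && (s < q) by rewrite pr sq orbT.
have h1 := ladder_share ab cd pq rs inc dec.
have h2 := ladder_share ab cd rs pq inc dec'.
have h3 := ladder_share cd ab pq rs inc' dec.
have h4 := ladder_share cd ab rs pq inc' dec'.
(* Each edge of the increasing pair shares an end with each edge of the decreasing pair, so the four
   edges join {u_a, u_c} completely to {v_b, v_d}. *)
have [/val_inj ap [/val_inj dq [/val_inj cr /val_inj bs]]] :
    a = p :> nat /\ d = q :> nat /\ c = r :> nat /\ b = s :> nat.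
  by clear -ac bd pr sq h1 h2 h3 h4; lia.
subst p q r s; exact: (ladder_no_K4 ladder outer ac bd ab pq rs cd).
Qed.

End Mixed.
End Ladder.

(** * Straight-line drawings *)

Section Segments.
Variable R : realType.
Implicit Types (x y p : plane R) (A : set (plane R)).

Lemma segmentC x y : segment x y = segment y x.
Proof.
suff h (a b : plane R) : segment a b `<=` segment b a by apply/seteqP; split; exact: h.
move=> p [t /=]; rewrite in_itv /= => /andP [t0 t1] <-.
exists (1 - t); first by rewrite /= ?in_itv /=; apply/andP; split; lra.
by rewrite scalerBl scale1r addrA [b + (a - b)]addrC subrK -scalerN opprB.
Qed.

Lemma segment_coord x y p : segment x y p -> exists2 t, 0 <= t <= 1 &
  p.1 = x.1 + t * (y.1 - x.1) /\ p.2 = x.2 + t * (y.2 - x.2).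
Proof. by move=> [t /=]; rewrite in_itv /= => ht <-; exists t. Qed.

Lemma segment_arc x y : x != y -> is_arc (segment x y) x y.
Proof.
move=> xy; exists (fun t => x + t *: (y - x)); split=> //.
- exact: segment_path_continuous.
- move=> s t _ _ /addrI /eqP; rewrite -subr_eq0 -scalerBl scaler_eq0.
  by rewrite !subr_eq0 [y == x]eq_sym (negbTE xy) orbF => /eqP.
- by rewrite scale0r addr0.
- by rewrite scale1r addrC subrK.
Qed.

Lemma convex_connected A : (forall x y, A x -> A y -> segment x y `<=` A) ->
  connected A.
Proof.
move=> convA; have [->|/set0P [x Ax]] := eqVneq A set0; first exact: connected0.
have -> : A = \bigcup_(y in A) segment x y.
  apply/seteqP; split=> [y Ay|p [y Ay]]; last exact: convA.
  by exists y => //; have [] := segment_continuum x y.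
apply: bigcup_connected.
  by exists x => y Ay; have [] := segment_continuum x y.
by move=> y Ay; have [[]] := segment_continuum x y.
Qed.

Lemma combination_gt (a b c t : R) : c < a -> c < b -> 0 <= t <= 1 ->
  c < a + t * (b - a).
Proof.
move=> ca cb /andP [t0 t1]; have [ab|/ltW ba] := leP a b.
  by have := mulr_ge0 t0 (_ : 0 <= b - a); rewrite subr_ge0 => /(_ ab); lra.
have := mulr_ge0 (_ : 0 <= 1 - t) (_ : 0 <= a - b); rewrite !subr_ge0.
by move=> /(_ t1 ba); lra.
Qed.

Lemma halfplane_connected (f : plane R -> R) (c : R) :
    (forall x y t, f (x + t *: (y - x)) = f x + t * (f y - f x)) ->
  connected [set p | c < f p].
Proof.
move=> affine; apply: convex_connected => x y /= cx cy p [t /= ht <-] /=.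
by rewrite affine; apply: combination_gt => //; rewrite in_itv /= in ht.
Qed.

(** The left half plane meets the other two; it links the region above the drawing, which touches
    the first path, to the one below, which touches the second. *)
Lemma box_exterior_connected (a b c : R) :
  connected ([set p : plane R | b < p.2] `|` [set p : plane R | p.1 < a] `|`
    [set p : plane R | p.2 < c]).
Proof.
have lower (f : plane R -> R) d : [set p | f p < d] = [set p | - d < - f p].
  by apply/seteqP; split=> p /=; rewrite ltrN2.
apply: connectedU; last 1 first.
- by rewrite lower; apply: halfplane_connected => x y t; rewrite /= /GRing.scale /=; ring.
- by exists (a - 1, c - 1) => /=; split; [right => /=; lra|lra].
apply: connectedU.
- by exists (a - 1, b + 1) => /=; split; lra.
- exact: halfplane_connected.
- by rewrite lower; apply: halfplane_connected => x y t; rewrite /= /GRing.scale /=; ring.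
Qed.

End Segments.

(** * The drawing of a ladder on two parallel lines *)

Section Drawing.
Variables (R : realType) (m n : nat) (G : sgraph).
Variables (u : 'I_m -> G) (v : 'I_n -> G).
Hypothesis ladder : generalized_ladder u v.
(* The second path is drawn from left to right if s = 1 and from right to left if
   s = -1. *)
Variable s : R.
Hypothesis s_sign : s = 1 \/ s = -1.
Hypothesis monotone : forall (i i' : 'I_m) (j j' : 'I_n),
  adj (u i) (v j) -> adj (u i') (v j') -> (i < i')%N -> s * j%:R <= s * j'%:R.
Variable pos : G -> plane R.
Hypothesis pos_u : forall i, pos (u i) = (i%:R, 1).
Hypothesis pos_v : forall j, pos (v j) = (s * j%:R, 0).

Let curve x y := segment (pos x) (pos y).

Lemma pos_injective : injective pos.
Proof.
move=> x y; have [[i ->]|[i ->]] := ladder_cover ladder x;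
have [[j ->]|[j ->]] := ladder_cover ladder y; rewrite ?pos_u ?pos_v => -[].
- by move/eqP; rewrite eqr_nat => /eqP /val_inj ->.
- by move=> _ /eqP; rewrite oner_eq0.
- by move=> _ /esym /eqP; rewrite oner_eq0.
- case: s_sign => ->; rewrite ?mul1r ?mulN1r; last move/oppr_inj;
  by move/eqP; rewrite eqr_nat => /eqP /val_inj ->.
Qed.

(** Ends are compared as unordered sets, so a path edge can be listed by increasing index.
    Multiplying an abscissa on the second path by s recovers the index; a cross edge is parametrized
    by its height. *)
Variant edge_point (x y : G) (p : plane R) : Prop :=
| EdgeU (i i' : 'I_m) of i.+1 = i' :> nat & [set x; y]%SET = [set u i; u i']%SET
    & p.2 = 1 & i%:R <= p.1 <= i%:R + 1
| EdgeV (j j' : 'I_n) of j.+1 = j' :> nat & [set x; y]%SET = [set v j; v j']%SET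
    & p.2 = 0 & j%:R <= s * p.1 <= j%:R + 1
| EdgeX (i : 'I_m) (j : 'I_n) of adj (u i) (v j)
    & [set x; y]%SET = [set u i; v j]%SET
    & 0 <= p.2 <= 1 & p.1 = s * j%:R + p.2 * (i%:R - s * j%:R).

Lemma edge_pointC x y p : edge_point x y p -> edge_point y x p.
Proof.
by case=> [i i'|j j'|i j] h; rewrite finset.setUC => *;
  [apply: (EdgeU h)|apply: (EdgeV h)|apply: (EdgeX h)].
Qed.

Lemma curve_point x y p : adj x y -> curve x y p -> edge_point x y p.
Proof.
move=> xy /segment_coord [t /andP [t0 t1] []]; move: xy.
have [[i ->]|[i ->]] := ladder_cover ladder x;
have [[j ->]|[j ->]] := ladder_cover ladder y; rewrite ?pos_u ?pos_v /=.
- rewrite (ladder_u_path ladder) => /orP [] /eqP ij p1 p2.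
    apply: (EdgeU ij) => //; first by lra.
    by move: p1; rewrite -ij -[i.+1]addn1 natrD => ->; apply/andP; split; lra.
  apply/edge_pointC/(EdgeU ij) => //; first by lra.
  by move: p1; rewrite -ij -[j.+1]addn1 natrD => ->; apply/andP; split; lra.
- move=> xy p1 p2; apply: (EdgeX xy) => //; rewrite p2; last by rewrite p1; ring.
  by apply/andP; split; lra.
- rewrite adj_sym => xy p1 p2; apply/edge_pointC/(EdgeX xy) => //; rewrite p2.
    by apply/andP; split; lra.
  by rewrite p1; ring.
- have ss : s * s = 1 by case: s_sign => ->; lra.
  rewrite (ladder_v_path ladder) => /orP [] /eqP ij p1 p2.
    apply: (EdgeV ij) => //; first by lra.
    rewrite p1 -ij -[i.+1]addn1 natrD.
    rewrite (_ : s * _ = (s * s) * (i%:R + t)); last by ring.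
    by rewrite ss; apply/andP; split; lra.
  apply/edge_pointC/(EdgeV ij) => //; first by lra.
  rewrite p1 -ij -[j.+1]addn1 natrD.
  rewrite (_ : s * _ = (s * s) * (j%:R + 1 - t)); last by ring.
  by rewrite ss; apply/andP; split; lra.
Qed.

Lemma straight_planar : planar_embedding pos curve.
Proof.
have ss : s * s = 1 by case: s_sign => ->; lra.
split.
- exact: pos_injective.
- by move=> x y _; rewrite /curve segmentC.
- move=> x y xy; apply: segment_arc; apply/eqP => /pos_injective e.
  by move: xy; rewrite e adj_irrefl.
- move=> x y z xy /(curve_point xy) h.
  suff : z \in [set x; y]%SET by rewrite !inE => /orP [] /eqP; [left|right].
  have uE := inj_eq (ladder_u_inj ladder); have vE := inj_eq (ladder_v_inj ladder).
  have [[k zk]|[k zk]] := ladder_cover ladder z; move: h; rewrite zk ?pos_u ?pos_v.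
    case=> [i i' ii -> /= _|j j' _ _ /= /eqP|i j _ -> /= _].
    + rewrite natr1 !ler_nat => ki.
      by rewrite !inE !uE -!val_eqE /=; lia.
    + by rewrite oner_eq0.
    + rewrite mul1r addrC subrK => /eqP; rewrite eqr_nat => ki.
      by rewrite !inE uE -val_eqE /= ki.
  case=> [i i' _ _ /= /esym /eqP|j j' jj -> /= _|i j _ -> /= _].
  + by rewrite oner_eq0.
  + rewrite mulrA ss mul1r natr1 !ler_nat => kj.
    by rewrite !inE !vE -!val_eqE /=; lia.
  + rewrite mul0r addr0 => /(congr1 ( *%R s)); rewrite !mulrA ss !mul1r => /eqP.
    by rewrite eqr_nat => kj; rewrite !inE vE -!val_eqE /= kj orbT.
- move=> x y x' y' xy xy' neq p [/(curve_point xy) h /(curve_point xy') h'].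
  have atu (i : 'I_m) : p.2 = 1 -> p.1 = i%:R -> range pos p.
    by case: (p) => a b /= -> ->; exists (u i).
  have atv (j : 'I_n) : p.2 = 0 -> s * p.1 = j%:R -> range pos p.
    case: (p) => a b /= -> sa; exists (v j) => //.
    by rewrite pos_v -sa mulrA ss mul1r.
  case: h neq => [i i' ii -> p2 p1|j j' jj -> p2 p1|i j ij -> p2 p1];
  case: h' => [k k' kk -> q2 q1|l l' ll -> q2 q1|k l kl -> q2 q1] neq.
  (* Two edges of the same path can meet only at the smaller end of the later one. *)
  + have [ik|ki|ik] := ltngtP i k.
    * apply: (atu k) => //; move: ik; rewrite -(ler_nat R) -natr1; lra.
    * apply: (atu i) => //; move: ki; rewrite -(ler_nat R) -natr1; lra.
    * have ik' : i = k by exact: val_inj.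
      have /val_inj ik'' : i' = k' :> nat by rewrite -ii -kk ik.
      by rewrite ik' ik'' eqxx in neq.
  + by move: p2; rewrite q2 => /esym /eqP; rewrite oner_eq0.
  + by apply: (atu k) => //; rewrite q1 p2 mul1r addrC subrK.
  + by move: p2; rewrite q2 => /eqP; rewrite oner_eq0.
  + have [jl|lj|jl] := ltngtP j l.
    * apply: (atv l) => //; move: jl; rewrite -(ler_nat R) -natr1; lra.
    * apply: (atv j) => //; move: lj; rewrite -(ler_nat R) -natr1; lra.
    * have jl' : j = l by exact: val_inj.
      have /val_inj jl'' : j' = l' :> nat by rewrite -jj -ll jl.
      by rewrite jl' jl'' eqxx in neq.
  + by apply: (atv l) => //; rewrite q1 p2 mul0r addr0 mulrA ss mul1r.
  + by apply: (atu i) => //; rewrite p1 q2 mul1r addrC subrK.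
  + by apply: (atv j) => //; rewrite p1 q2 mul0r addr0 mulrA ss mul1r.
  + have [p0|p0] := eqVneq p.2 0.
      by apply: (atv j) => //; rewrite p1 p0 mul0r addr0 mulrA ss mul1r.
    have [p3|p3] := eqVneq p.2 1.
      by apply: (atu i) => //; rewrite p1 p3 mul1r addrC subrK.
    have {p0 p3 p2 q2} [t0 t1] : 0 < p.2 /\ p.2 < 1.
      by move: p2; rewrite !le_eqVlt eq_sym (negbTE p0) (negbTE p3) => /andP.
    (* At a height strictly between 0 and 1 the abscissa grows strictly with the upper end and
       weakly with the lower one, so [monotone] separates cross edges with different upper ends. *)
    have strict (a b a' b' : R) : a < a' -> b <= b' ->
        b + p.2 * (a - b) != b' + p.2 * (a' - b').
      move=> aa bb; rewrite lt_eqF // -subr_gt0.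
      have ta : 0 < p.2 * (a' - a) by rewrite mulr_gt0 // subr_gt0.
      have tb : 0 <= (1 - p.2) * (b' - b) by rewrite mulr_ge0 // subr_ge0 // ltW.
      lra.
    move: q1; rewrite p1; have [ik|ki|ik] := ltngtP i k.
    * move=> /eqP; rewrite (negbTE (strict _ _ _ _ _ (monotone ij kl ik))) //.
      by rewrite ltr_nat.
    * move=> /esym /eqP; rewrite (negbTE (strict _ _ _ _ _ (monotone kl ij ki))) //.
      by rewrite ltr_nat.
    * rewrite ik => e.
      have e' : (1 - p.2) * (s * j%:R - s * l%:R) = 0 by lra.
      move: e' => /eqP; rewrite mulf_eq0 subr_eq0 [1 == _]eq_sym lt_eqF //=.
      rewrite subr_eq0 => /eqP /(congr1 ( *%R s)); rewrite !mulrA ss !mul1r => /eqP.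
      rewrite eqr_nat => /eqP /val_inj jl.
      by move: neq; rewrite jl (val_inj ik) eqxx.
Qed.

Lemma straight_outerplanar : outerplanar R G.
Proof.
have ss : s * s = 1 by case: s_sign => ->; lra.
exists pos, curve; split; first exact: straight_planar.
(* Every abscissa is at least -M, also when the second path is reversed. *)
pose M : R := m%:R + n%:R.
pose O := [set p : plane R | 1 < p.2] `|` [set p | p.1 < - M] `|` [set p | p.2 < 0].
have boxed p : drawing pos curve p -> - M <= p.1 /\ 0 <= p.2 <= 1.
  have box_u (i : 'I_m) : - M <= i%:R.
    have := ler0n R i; have := ler0n R m; have := ler0n R n; rewrite /M; lra.
  have box_v (j : 'I_n) : - M <= s * j%:R.
    have jn : j%:R <= n%:R :> R by rewrite ler_nat ltnW.
    have := ler0n R m; have := ler0n R j; rewrite /M; case: s_sign => ->; lra.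
  case=> [[x _ <-]|[x [y [xy /(curve_point xy)]]]].
    have [[i ->]|[j ->]] := ladder_cover ladder x; rewrite ?pos_u ?pos_v /=.
      by split; [exact: box_u|rewrite ler01 lexx].
    by split; [exact: box_v|rewrite ler01 lexx].
  case=> [i i' _ _ p2 p1|j j' jj _ p2 p1|i j _ _ p2 p1].
  - by split; [have := box_u i; lra|rewrite p2 ler01 lexx].
  - split; last by rewrite p2 ler01 lexx.
    have := box_v j; have := box_v j'; rewrite -jj -natr1; move: p1.
    case: s_sign => ->; lra.
  - split=> //; rewrite p1.
    have := box_u i; have := box_v j; case/andP: p2 => t0 t1 bv bu.
    have tu : 0 <= p.2 * (i%:R + M) by rewrite mulr_ge0 //; lra.
    have tv : 0 <= (1 - p.2) * (s * j%:R + M) by rewrite mulr_ge0 //; lra.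
    lra.
have outO : O `<=` ~` drawing pos curve.
  move=> p Op /boxed [p1 /andP [p2 p3]].
  by case: Op => [[]|] /=; lra.
have top : O (0, 2) by left; left => /=; lra.
have cO : connected O by exact: box_exterior_connected.
have OF : O `<=` connected_component (~` drawing pos curve) (0, 2).
  exact: connected_component_max.
exists (connected_component (~` drawing pos curve) (0, 2)); split.
  split; first by exists (0, 2) => //; exact: outO.
  (* Boundedness would bound the norm on the face by |N| + 1, which the point (0, |N| + 2)
     exceeds. *)
  case=> N [_ /(_ (`|N| + 1))].
  have NN : N < `|N| + 1 by have := ler_norm N; lra.
  move=> /(_ NN (0, `|N| + 2)); have N0 := normr_ge0 N.
  have /OF h : O (0, `|N| + 2) by left; left => /=; lra.
  move=> /(_ h) /=; rewrite plane_normE ge_max /= => /andP [_].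
  by rewrite ger0_norm; lra.
move=> x B /nbhs_ballP [e /= e0 eB].
(* Vertices of the first path are approached from above, those of the second from below. *)
have [[i xi]|[j xj]] := ladder_cover ladder x.
  exists (i%:R, 1 + e / 2); split; first by apply: OF; left; left => /=; lra.
  apply: eB; rewrite xi pos_u -ball_normE /= plane_normE /= gt_max subrr normr0 e0 /=.
  by rewrite opprD addrA subrr sub0r normrN gtr0_norm; lra.
exists (s * j%:R, - (e / 2)); split; first by apply: OF; right => /=; lra.
apply: eB; rewrite xj pos_v -ball_normE /= plane_normE /= gt_max subrr normr0 e0 /=.
by rewrite sub0r opprK gtr0_norm; lra.
Qed.

End Drawing.

Lemma monotone_outerplanar (R : realType) (m n : nat) (G : sgraph)
    (u : 'I_m -> G) (v : 'I_n -> G) (s : R) :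
    generalized_ladder u v -> s = 1 \/ s = -1 ->
    (forall (i i' : 'I_m) (j j' : 'I_n), adj (u i) (v j) ->
      adj (u i') (v j') -> (i < i')%N -> s * j%:R <= s * j'%:R) ->
  outerplanar R G.
Proof.
move=> ladder s_sign mono.
have /choice [pos hpos] (z : G) : exists p : plane R,
    (forall i, z = u i -> p = (i%:R, 1)) /\ (forall j, z = v j -> p = (s * j%:R, 0)).
  have [[i ->]|[j ->]] := ladder_cover ladder z.
    exists (i%:R, 1); split=> [i' /(ladder_u_inj ladder) -> //|j].
    by move=> /(ladder_disjoint ladder).
  exists (s * j%:R, 0); split=> [i /esym /(ladder_disjoint ladder) //|j'].
  by move=> /(ladder_v_inj ladder) ->.
apply: (straight_outerplanar ladder s_sign mono (pos := pos)) => [i|j].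
  by have [+ _] := hpos (u i); exact.
by have [_] := hpos (v j); exact.
Qed.

Theorem theorem4 (R : realType) (m n : nat) (G : sgraph)
    (u : 'I_m -> G) (v : 'I_n -> G) :
  (0 < m)%N -> (0 < n)%N ->
  generalized_ladder u v ->
  (outerplanar R G <->
   (forall e, e \in cross_edges u v ->
      (Lup u v e :&: Rup u v e)%SET = finset.set0 /\
      (Ldown u v e :&: Rdown u v e)%SET = finset.set0) \/
   (forall e, e \in cross_edges u v ->
      (Lup u v e :&: Rdown u v e)%SET = finset.set0 /\
      (Ldown u v e :&: Rup u v e)%SET = finset.set0)).
Proof.
move=> _ _ ladder; split=> [outer|cond].
  (* An increasing pair of cross edges excludes every decreasing pair, which gives (ii); without an
     increasing pair, (i) holds. *)
  have [inc|not_inc] := pselect (exists a b c d,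
    [/\ adj (u a) (v b), adj (u c) (v d), (a < c)%N & (b < d)%N]).
    right=> e; rewrite inE => ee; case: inc => a [b [c [d [ab cd ac bd]]]].
    split; apply/setP => f; rewrite !inE; apply/negP;
      move=> /andP [/andP [ff lf] /andP [_ rf]].
    + exact: (ladder_no_increasing_decreasing ladder outer ab cd ac bd ee ff lf rf).
    + exact: (ladder_no_increasing_decreasing ladder outer ab cd ac bd ff ee lf rf).
  left=> e; rewrite inE => ee.
  split; apply/setP => f; rewrite !inE; apply/negP;
    move=> /andP [/andP [ff lf] /andP [_ rf]]; apply: not_inc.
  + by exists e.1, e.2, f.1, f.2.
  + by exists f.1, f.2, e.1, e.2.
case: cond => cond.
  (* Under (i) the second index weakly decreases as the first grows, so the second path is
     reversed. *)
  apply: (monotone_outerplanar (s := -1) ladder); first by right.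
  move=> i i' j j' ij ij' ii; rewrite !mulN1r lerN2 ler_nat leqNgt; apply/negP => jj.
  have [|+ _] := cond (i, j); first by rewrite inE.
  by move=> /setP /(_ (i', j')); rewrite !inE /= ij' /lidx /ridx /= ii jj.
apply: (monotone_outerplanar (s := 1) ladder); first by left.
move=> i i' j j' ij ij' ii; rewrite !mul1r ler_nat leqNgt; apply/negP => jj.
have [|+ _] := cond (i, j); first by rewrite inE.
by move=> /setP /(_ (i', j')); rewrite !inE /= ij' /lidx /ridx /= ii jj.
Qed.
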